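(* Let $(\mathfrak g,\omega,J)$ be a nonzero finite-dimensional real pseudo-Kähler $3$-Lie algebra. Then $(\mathfrak g_{\mathbb C},\omega_{\mathbb C},E)$ is a complex para-Kähler $3$-Lie algebra, where $\mathfrak g_{\mathbb C}=\mathfrak g\otimes_{\mathbb R}\mathbb C$ is the complexification of $\mathfrak g$, $E=-iJ_{\mathbb C}$ with $J_{\mathbb C}(x+iy)=Jx+iJy$ for $x,y\in\mathfrak g$, and $\omega_{\mathbb C}$ is the complexification of $\omega$, i.e. $$\omega_{\mathbb C}(x_1+iy_1,x_2+iy_2)=\omega(x_1,x_2)-\omega(y_1,y_2)+i\omega(x_1,y_2)+i\omega(y_1,x_2),\quad x_1,x_2,y_1,y_2\in\mathfrak g.$$
   Context: A $3$-Lie algebra is a vector space $\mathfrak g$ with a trilinear skew-symmetric bracket satisfying $[x,y,[z,w,v]]=[[x,y,z],w,v]+[z,[x,y,w],v]+[z,w,[x,y,v]]$. The complexification $\mathfrak g_{\mathbb C}$ of a real $3$-Lie algebra carries the complex-trilinear extension of the bracket. A symplectic structure on $\mathfrak g$ is a nondegenerate skew-symmetric bilinear form $\omega$ with $\omega([x,y,z],w)-\omega([y,z,w],x)+\omega([z,w,x],y)-\omega([w,x,y],z)=0$. A complex structure on a real $3$-Lie algebra is a linear map $J$ with $J^2=-\mathrm{Id}$ and $J[x,y,z]=-[Jx,Jy,Jz]+[Jx,y,z]+[x,Jy,z]+[x,y,Jz]+J[Jx,Jy,z]+J[x,Jy,Jz]+J[Jx,y,Jz]$. A real pseudo-Kähler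 $3$-Lie algebra is a triple $(\mathfrak g,\omega,J)$ with $\mathfrak g$ a real $3$-Lie algebra, $\omega$ a symplectic structure, $J$ a complex structure and $\omega(Jx,Jy)=\omega(x,y)$ for all $x,y\in\mathfrak g$. A product structure on $\mathfrak g$ is a linear map $E:\mathfrak g\to\mathfrak g$ with $E^2=\mathrm{Id}$, $E\neq\pm\mathrm{Id}$ and $E[x,y,z]=[Ex,Ey,Ez]+[Ex,y,z]+[x,Ey,z]+[x,y,Ez]-E[Ex,Ey,z]-E[x,Ey,Ez]-E[Ex,y,Ez]$. A paracomplex structure is a product structure whose $\pm1$-eigenspaces have the same dimension. A para-Kähler $3$-Lie algebra is a triple $(\mathfrak g,\omega,E)$ with $\omega$ symplectic, $E$ paracomplex and $\omega(Ex,Ey)=-\omega(x,y)$ for all $x,y$; it is complex if $\mathfrak g$ is a complex $3$-Lie algebra (all maps and forms being complex (multi)linear). *)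

(* Defs.v *)
From HB Require Import structures.
From mathcomp Require Import all_boot all_order all_algebra.
From mathcomp Require Import reals.
From mathcomp.real_closed Require Import complex.

Set Implicit Arguments.
Unset Strict Implicit.
Unset Printing Implicit Defensive.

Import GRing.Theory.
Local Open Scope ring_scope.
Local Open Scope complex_scope.

Definition trilinear (K : fieldType) (V : vectType K) (br : V -> V -> V -> V) :
    Prop :=
  [/\ forall y z, linear (fun x => br x y z),
      forall x z, linear (fun y => br x y z)
    & forall x y, linear (fun z => br x y z)].

(* The transpositions (1 2) and (2 3) generate 'S_3, so sign changes under
   these two give skew-symmetry in all three arguments. *)
Definition skew3 (K : fieldType) (V : vectType K) (br : V -> V -> V -> V) :
    Prop :=
  (forall x y z, br y x z = - br x y z) /\ (forall x y z, br x z y = - br x y z).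

Record lie3_algebra (K : fieldType) (V : vectType K)
    (br : V -> V -> V -> V) : Prop := Lie3Algebra {
  lie3_trilinear : trilinear br;
  lie3_skew : skew3 br;
  lie3_fundamental : forall x y z w v,
    br x y (br z w v) = br (br x y z) w v + br z (br x y w) v + br z w (br x y v)
}.

Record symplectic_structure (K : fieldType) (V : vectType K)
    (br : V -> V -> V -> V) (omega : V -> V -> K) : Prop :=
  SymplecticStructure {
  symplectic_linearl : forall y, scalar (fun x => omega x y);
  symplectic_linearr : forall x, scalar (omega x);
  symplectic_skew : forall x y, omega y x = - omega x y;
  symplectic_nondegenerate : forall x, (forall y, omega x y = 0) -> x = 0;
  symplectic_closed : forall x y z w,
    omega (br x y z) w - omega (br y z w) x
      + omega (br z w x) y - omega (br w x y) z = 0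
}.

Record complex_structure (R : realType) (V : vectType R)
    (br : V -> V -> V -> V) (J : 'End(V)) : Prop := ComplexStructure {
  complex_structure_sqr : forall x, J (J x) = - x;
  complex_structure_integrable : forall x y z,
    J (br x y z) =
      - br (J x) (J y) (J z) + br (J x) y z + br x (J y) z + br x y (J z)
      + J (br (J x) (J y) z) + J (br x (J y) (J z)) + J (br (J x) y (J z))
}.

Record pseudo_kahler (R : realType) (V : vectType R)
    (br : V -> V -> V -> V) (omega : V -> V -> R) (J : 'End(V)) : Prop :=
  PseudoKahler {
  pseudo_kahler_lie3 : lie3_algebra br;
  pseudo_kahler_symplectic : symplectic_structure br omega;
  pseudo_kahler_complex : complex_structure br J;
  pseudo_kahler_compatible : forall x y, omega (J x) (J y) = omega x y
}.

Record product_structure (K : fieldType) (V : vectType K)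
    (br : V -> V -> V -> V) (E : 'End(V)) : Prop := ProductStructure {
  product_structure_sqr : forall x, E (E x) = x;
  product_structure_neq1 : E <> \1%VF;
  product_structure_neqN1 : E <> - \1%VF;
  product_structure_integrable : forall x y z,
    E (br x y z) =
      br (E x) (E y) (E z) + br (E x) y z + br x (E y) z + br x y (E z)
      - E (br (E x) (E y) z) - E (br x (E y) (E z)) - E (br (E x) y (E z))
}.

Record paracomplex_structure (K : fieldType) (V : vectType K)
    (br : V -> V -> V -> V) (E : 'End(V)) : Prop := ParacomplexStructure {
  paracomplex_product : product_structure br E;
  paracomplex_dim : \dim (passmx.leigenspace E 1) = \dim (passmx.leigenspace E (-1))
}.

Record para_kahler (K : fieldType) (V : vectType K)
    (br : V -> V -> V -> V) (omega : V -> V -> K) (E : 'End(V)) : Prop :=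
  ParaKahler {
  para_kahler_lie3 : lie3_algebra br;
  para_kahler_symplectic : symplectic_structure br omega;
  para_kahler_paracomplex : paracomplex_structure br E;
  para_kahler_compatible : forall x y, omega (E x) (E y) = - omega x y
}.

(* V (x)_R C modelled on V * V, with (x, y) standing for x + i y. The constant
   keeps this type apart from V * V, whose canonical scalars are real. *)
Definition complexification (R : realType) (V : vectType R) : Type := (V * V)%type.

HB.instance Definition _ (R : realType) (V : vectType R) :=
  GRing.Zmodule.copy (complexification V) (V * V)%type.

Section ComplexificationVector.
Import VectorInternalTheory.
Variables (R : realType) (V : vectType R).
Local Notation VC := (complexification V).
Implicit Types (a b : R[i]) (u v : VC).

Definition complexification_scale a u : VC :=
  (Re a *: u.1 - Im a *: u.2, Re a *: u.2 + Im a *: u.1).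

Fact complexification_scaleA a b u :
  complexification_scale a (complexification_scale b u) =
  complexification_scale (a * b) u.
Proof.
case: a b u => [a1 a2] [b1 b2] [x y]; rewrite /complexification_scale /=.
rewrite !(scalerDr, scalerN, scalerBl, scalerDl, scalerA) !(opprD, opprK).
by congr (_, _); rewrite [X in _ + X = _]addrC addrACA.
Qed.

Fact complexification_scale1 : left_id 1 complexification_scale.
Proof.
by case=> x y; rewrite /complexification_scale /= !scale1r !scale0r subr0 addr0.
Qed.

Fact complexification_scaleDr : right_distributive complexification_scale +%R.
Proof.
move=> a [x y] [x' y']; rewrite /complexification_scale /=.
by congr (_, _); rewrite !scalerDr ?opprD addrACA.
Qed.

Fact complexification_scaleDl u :
  {morph complexification_scale^~ u : a b / a + b}.
Proof.
move=> [a1 a2] [b1 b2]; case: u => x y; rewrite /complexification_scale /=.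
by congr (_, _); rewrite !scalerDl ?opprD addrACA.
Qed.

HB.instance Definition _ := GRing.Zmodule_isLmodule.Build R[i] VC
  complexification_scaleA complexification_scale1
  complexification_scaleDr complexification_scaleDl.

Lemma complexification_scaleE a u :
  a *: u = (Re a *: u.1 - Im a *: u.2, Re a *: u.2 + Im a *: u.1) :> VC.
Proof. by []. Qed.

Fact complexification_vect_iso : Vector.axiom (dim V) VC.
Proof.
exists (fun u => \row_j (v2r u.1 0 j +i* v2r u.2 0 j)).
  move=> [a1 a2] [x y] [x' y']; apply/rowP => j.
  rewrite !mxE; apply/eqP; rewrite eq_complex /=.
  by apply/andP; split; apply/eqP; rewrite !(linearD, linearN, linearZ) !mxE ?mulrN.
exists (fun r : 'rV[R[i]]_(dim V) =>
  (r2v (\row_j Re (r 0 j)), r2v (\row_j Im (r 0 j))) : VC).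
  by case=> x y; congr (_, _); rewrite -[RHS]v2rK; congr r2v;
     apply/rowP => j; rewrite !mxE.
by move=> r; apply/rowP => j; rewrite !mxE /= !r2vK !mxE; case: (r 0 j).
Qed.

HB.instance Definition _ :=
  Lmodule_hasFinDim.Build R[i] VC complexification_vect_iso.

End ComplexificationVector.

(* The complex-trilinear extension, expanded using i ^ 2 = -1. *)
Definition complexify_bracket (R : realType) (V : vectType R)
    (br : V -> V -> V -> V) (u v w : complexification V) : complexification V :=
  (br u.1 v.1 w.1 - br u.1 v.2 w.2 - br u.2 v.1 w.2 - br u.2 v.2 w.1,
   br u.2 v.1 w.1 + br u.1 v.2 w.1 + br u.1 v.1 w.2 - br u.2 v.2 w.2).

Definition complexify_form (R : realType) (V : vectType R)
    (omega : V -> V -> R) (u v : complexification V) : R[i] :=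
  (omega u.1 v.1 - omega u.2 v.2) +i* (omega u.1 v.2 + omega u.2 v.1).

Definition complexify_fun (R : realType) (V : vectType R) (J : 'End(V))
    (u : complexification V) : complexification V := (J u.1, J u.2).

Fact complexify_fun_is_linear (R : realType) (V : vectType R) (J : 'End(V)) :
  linear (complexify_fun J).
Proof.
move=> [a b] [x y] [x' y']; rewrite /complexify_fun /=.
rewrite complexification_scaleE /=.
by congr (_, _); rewrite !(linearD, linearN, linearZ) /= ?linearN.
Qed.

HB.instance Definition _ (R : realType) (V : vectType R) (J : 'End(V)) :=
  GRing.isLinear.Build R[i] (complexification V) (complexification V) *:%R
    (complexify_fun J) (complexify_fun_is_linear J).

Definition complexify_end (R : realType) (V : vectType R) (J : 'End(V)) :
    'End(complexification V) := linfun (complexify_fun J).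

Lemma complexify_endE (R : realType) (V : vectType R) (J : 'End(V))
    (u : complexification V) : complexify_end J u = (J u.1, J u.2).
Proof. exact: lfunE. Qed.

(* Main.v *)
From HB Require Import structures.
Require Import Defs.
From mathcomp Require Import all_boot all_order all_algebra.
From mathcomp Require Import reals ring.
From mathcomp.real_closed Require Import complex.

Set Implicit Arguments.
Unset Strict Implicit.
Unset Printing Implicit Defensive.

Import GRing.Theory VectorInternalTheory.
Local Open Scope ring_scope.

(** The complexified triple satisfies every required identity because both
    sides are complex multilinear and the real vectors span g_C over C: two
    multilinear maps agreeing on real vectors are equal.  Applied one argument
    at a time ([complexification_ind]), this transports the fundamental identity
    ([complexify_lie3]), the closedness of the form ([complexify_symplectic])
    and the integrability of J ([complexify_nijenhuis]).  Nondegeneracy of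
    omega_C follows by pairing with real vectors, where the real and imaginary
    parts of the pairing separate.

    Multiplying J_C by -i turns the complex identities into the paracomplex
    ones.  Squaring gives E ^ 2 = - J_C ^ 2 = id and
    omega_C (E u, E v) = (-i) ^ 2 omega_C (u, v).  In the integrability
    identity every term contains an odd number of copies of J, so substituting
    J_C = i E and dividing by i flips the sign of exactly the terms with three
    copies ([nijenhuis_product]).  In terms of pairs, E (x, y) = (J y, - J x):
    it exchanges the real and the imaginary vectors, so it is neither id nor
    - id as soon as g is nonzero.

    Finally E anticommutes with the conjugation of g_C, so conjugation maps the
    eigenspaces of 1 and -1 into each other.  It is injective and semilinear,
    hence cannot decrease dimensions ([dim_semilinear]), and the two
    eigenspaces have the same dimension. *)

(** * Identities in vector spaces through coordinates *)

Lemma coordE (K : fieldType) (V : vectType K) (j : 'I_(dim V)) :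
  (forall u v : V, v2r (u + v) 0 j = v2r u 0 j + v2r v 0 j) *
  (forall u : V, v2r (- u) 0 j = - v2r u 0 j) *
  (forall a (u : V), v2r (a *: u) 0 j = a * v2r u 0 j).
Proof. by do !split=> *; rewrite !(linearD, linearN, linearZ) mxE. Qed.

(** Reading an identity between linear combinations in each coordinate turns it
    into a commutative ring identity. *)
Ltac vector_ring := apply: v2r_inj; apply/rowP => ?; rewrite !coordE; ring.

(** * Multilinear maps given by unbundled hypotheses *)

(** The scaling law [s] is a parameter so that vector-valued maps and forms are
    covered at once. *)
Lemma linear_forE (K : fieldType) (U : lmodType K) (W : zmodType)
    (s : GRing.Scale.law K W) (f : U -> W) (f_lin : GRing.linear_for s f) :
  (forall u v, f (u + v) = f u + f v) * (forall u, f (- u) = - f u) *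
  (forall a u, f (a *: u) = s a (f u)) * (f 0 = 0).
Proof.
pose F : {linear U -> W | s} :=
  HB.pack f (GRing.isLinear.Build K U W s f f_lin).
split; last exact: (linear0 F).
split; last exact: (linearZ_LR F).
by split; [exact: (linearD F) | exact: (linearN F)].
Qed.

Section TrilinearMap.
Variables (K : fieldType) (V : vectType K) (br : V -> V -> V -> V).
Hypothesis br_tri : trilinear br.

Lemma trilinear1E y z :
  (forall u v, br (u + v) y z = br u y z + br v y z) *
  (forall u, br (- u) y z = - br u y z) *
  (forall a u, br (a *: u) y z = a *: br u y z) * (br 0 y z = 0).
Proof. by case: br_tri => lin _ _; exact: (linear_forE (lin y z)). Qed.

Lemma trilinear2E x z :
  (forall u v, br x (u + v) z = br x u z + br x v z) *
  (forall u, br x (- u) z = - br x u z) *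
  (forall a u, br x (a *: u) z = a *: br x u z) * (br x 0 z = 0).
Proof. by case: br_tri => _ lin _; exact: (linear_forE (lin x z)). Qed.

Lemma trilinear3E x y :
  (forall u v, br x y (u + v) = br x y u + br x y v) *
  (forall u, br x y (- u) = - br x y u) *
  (forall a u, br x y (a *: u) = a *: br x y u) * (br x y 0 = 0).
Proof. by case: br_tri => _ _ lin; exact: (linear_forE (lin x y)). Qed.

Definition trilinearE := (trilinear1E, trilinear2E, trilinear3E).

End TrilinearMap.

(** Transposing arguments carries linearity from the first slot to the others. *)
Lemma skew3_trilinear (K : fieldType) (V : vectType K) (br : V -> V -> V -> V) :
  skew3 br -> (forall y z, linear (fun x => br x y z)) -> trilinear br.
Proof.
move=> [sk12 sk23] lin1.
have lin2 x z : linear (fun y => br x y z).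
  by move=> a u v /=; rewrite !(sk12 _ x) lin1 scalerN opprD.
by split=> // x y a u v /=; rewrite !(sk23 x _ y) lin2 scalerN opprD.
Qed.

(** * Real vectors span the complexification *)

Section Complexification.
Variables (R : realType) (V : vectType R).
Local Notation VC := (complexification V).

Definition real_vector (x : V) : VC := (x, 0).

Lemma complexificationD (u v : VC) : u + v = (u.1 + v.1, u.2 + v.2).
Proof. by []. Qed.

(** Since (x, y) = x + i y with x and y real, a property stable
    under complex linear combinations only has to be checked on real vectors. *)
Lemma complexification_ind (P : VC -> Prop) :
    (forall x, P (real_vector x)) ->
    (forall a u v, P u -> P v -> P (a *: u + v)) ->
  forall u, P u.
Proof.
move=> Preal Plin [x y].
suff -> : (x, y) = 'i%C *: real_vector y + real_vector x :> VC by exact: Plin.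
rewrite complexification_scaleE complexificationD /=.
by rewrite !scale0r !scale1r subrr !addr0 !add0r.
Qed.

Lemma trilinear_ext0 (f : VC -> VC -> VC -> VC) : trilinear f ->
    (forall x y z, f (real_vector x) (real_vector y) (real_vector z) = 0) ->
  forall u v w, f u v w = 0.
Proof.
move=> [f1 f2 f3] f0.
elim/complexification_ind=> [x|a u u' IH IH'] v w; last first.
  by rewrite f1 IH IH' scaler0 addr0.
elim/complexification_ind: v w => [y|a v v' IH IH'] w; last first.
  by rewrite f2 IH IH' scaler0 addr0.
elim/complexification_ind: w => [z|a w w' IH IH'] //.
by rewrite f3 IH IH' scaler0 addr0.
Qed.

End Complexification.

(** * The complexified 3-Lie algebra *)

Section Bracket.
Variables (R : realType) (V : vectType R) (br : V -> V -> V -> V).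
Local Notation VC := (complexification V).
Local Notation brC := (complexify_bracket br).

Lemma complexify_skew : skew3 br -> skew3 brC.
Proof.
move=> [sk12 sk23]; split=> u v w; rewrite /complexify_bracket.
  rewrite !(sk12 u.1) !(sk12 u.2); congr (_, _); vector_ring.
rewrite !(sk23 _ v.1) !(sk23 _ v.2); congr (_, _); vector_ring.
Qed.

Lemma complexify_trilinear : skew3 br -> trilinear br -> trilinear brC.
Proof.
move=> br_skew br_tri; apply: skew3_trilinear; first exact: complexify_skew.
move=> v w a u u'; rewrite /complexify_bracket !complexification_scaleE.
rewrite !complexificationD /= !(trilinear1E br_tri).
congr (_, _); vector_ring.
Qed.

Lemma complexify_bracket_real x y z : trilinear br ->
  brC (real_vector x) (real_vector y) (real_vector z) =
  real_vector (br x y z).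
Proof.
move=> br_tri; rewrite /complexify_bracket /= !(trilinearE br_tri).
by rewrite !subr0 !addr0.
Qed.

(** The fundamental identity is linear in each of its five arguments, which can
    therefore be assumed real one after the other. *)
Lemma complexify_lie3 : lie3_algebra br -> lie3_algebra brC.
Proof.
move=> [br_tri br_skew br_fund].
have brC_tri := complexify_trilinear br_skew br_tri.
split=> //; first exact: complexify_skew.
elim/complexification_ind=> [x|a x x' IH IH']; last first.
  move=> y z w v; rewrite !(trilinearE brC_tri) IH IH'; vector_ring.
elim/complexification_ind=> [y|a y y' IH IH']; last first.
  move=> z w v; rewrite !(trilinearE brC_tri) IH IH'; vector_ring.
elim/complexification_ind=> [z|a z z' IH IH']; last first.
  move=> w v; rewrite !(trilinearE brC_tri) IH IH'; vector_ring.
elim/complexification_ind=> [w|a w w' IH IH']; last first.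
  move=> v; rewrite !(trilinearE brC_tri) IH IH'; vector_ring.
elim/complexification_ind=> [v|a v v' IH IH']; last first.
  rewrite !(trilinearE brC_tri) IH IH'; vector_ring.
rewrite !complexify_bracket_real // br_fund.
by rewrite !complexificationD /= !addr0.
Qed.

End Bracket.

(** * The complexified symplectic form *)

Section ClosedDefect.
Variables (K : fieldType) (V : vectType K) (br : V -> V -> V -> V).
Variable omega : V -> V -> K.

Definition closed_defect x y z w :=
  omega (br x y z) w - omega (br y z w) x
    + omega (br z w x) y - omega (br w x y) z.

(** Rotation brings any argument to the front, so that linearity in the first
    argument suffices. *)
Lemma closed_defect_rot x y z w :
  closed_defect x y z w = - closed_defect y z w x.
Proof. by rewrite /closed_defect; ring. Qed.

Lemma closed_defect_linear : trilinear br ->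
    (forall y, scalar (fun x => omega x y)) -> (forall x, scalar (omega x)) ->
  forall y z w, scalar (fun x => closed_defect x y z w).
Proof.
move=> [br1 br2 br3] om1 om2 y z w a x x'.
rewrite /closed_defect br1 br2 br3 !om1 om2; ring.
Qed.

End ClosedDefect.

Section Form.
Variables (R : realType) (V : vectType R) (br : V -> V -> V -> V).
Variable omega : V -> V -> R.
Local Notation VC := (complexification V).
Local Notation brC := (complexify_bracket br).
Local Notation omegaC := (complexify_form omega).
Local Open Scope complex_scope.

Lemma complexify_form_real x y : symplectic_structure br omega ->
  omegaC (real_vector x) (real_vector y) = (omega x y)%:C.
Proof.
move=> [lin1 lin2 _ _ _]; rewrite /complexify_form /=.
rewrite !(linear_forE (lin1 _)) !(linear_forE (lin2 _)).
by rewrite subr0 addr0.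
Qed.

Lemma complexify_form_linearl :
    (forall y, scalar (fun x => omega x y)) ->
  forall v, scalar (fun u => omegaC u v).
Proof.
move=> lin1 v [a b] u u'; rewrite /complexify_form complexification_scaleE.
rewrite complexificationD /= !(linear_forE (lin1 _)).
by apply/eqP; rewrite eq_complex /=; apply/andP; split; apply/eqP; ring.
Qed.

Lemma complexify_form_skew :
    (forall x y, omega y x = - omega x y) ->
  forall u v, omegaC v u = - omegaC u v.
Proof.
move=> om_skew u v; rewrite /complexify_form.
rewrite !(om_skew u.1) !(om_skew u.2).
by apply/eqP; rewrite eq_complex /=; apply/andP; split; apply/eqP; ring.
Qed.

Lemma complexify_symplectic : lie3_algebra br ->
  symplectic_structure br omega -> symplectic_structure brC omegaC.
Proof.
move=> br_lie om_sympl.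
have brC_tri := lie3_trilinear (complexify_lie3 br_lie).
have [lin1 lin2 om_skew om_nondeg om_closed] := om_sympl.
have linC1 := complexify_form_linearl lin1.
have omC_skew := complexify_form_skew om_skew.
have linC2 u : scalar (omegaC u).
  move=> a v v'; rewrite !(omC_skew _ u) (linC1 u); ring.
split=> //.
- move=> [x y] om0.
  have om_re z : omega x z = 0 /\ omega y z = 0.
    have := om0 (real_vector z); rewrite /complexify_form /=.
    by rewrite !(linear_forE (lin2 _)) subr0 add0r => -[-> ->].
  have [-> ->] // : x = 0 /\ y = 0.
  by split; apply: om_nondeg => z; case: (om_re z).
have lin := closed_defect_linear brC_tri linC1 linC2.
(* Each round reduces the first argument to a real one, then rotates. *)
suff clo u v w t : closed_defect brC omegaC u v w t = 0 by move=> *; exact: clo.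
have step := fun a u u' v w t => lin v w t a u u'.
elim/complexification_ind: u v w t => [x|a u u' IH IH'] v w t; last first.
  by rewrite step IH IH' mulr0 addr0.
rewrite closed_defect_rot.
elim/complexification_ind: v w t => [y|a v v' IH IH'] w t; last first.
  by rewrite step opprD -mulrN IH IH' mulr0 addr0.
rewrite closed_defect_rot opprK.
elim/complexification_ind: w t => [z|a w w' IH IH'] t; last first.
  by rewrite step IH IH' mulr0 addr0.
rewrite closed_defect_rot.
elim/complexification_ind: t => [t|a t t' IH IH']; last first.
  by rewrite step opprD -mulrN IH IH' mulr0 addr0.
rewrite closed_defect_rot opprK.
have br_tri := lie3_trilinear br_lie.
rewrite /closed_defect !complexify_bracket_real // !complexify_form_real //.
by rewrite -!(rmorphN, rmorphD) om_closed.
Qed.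

End Form.

(** * Integrability of complex and product structures *)

Section Nijenhuis.
Variables (K : fieldType) (V : vectType K) (br : V -> V -> V -> V).
Hypothesis br_tri : trilinear br.

Definition nijenhuis (J : 'End(V)) x y z :=
  J (br x y z) - (- br (J x) (J y) (J z)
    + br (J x) y z + br x (J y) z + br x y (J z)
    + J (br (J x) (J y) z) + J (br x (J y) (J z)) + J (br (J x) y (J z))).

Lemma nijenhuis_trilinear J : trilinear (nijenhuis J).
Proof.
have Jlin : linear J := linearP J.
have [br1 br2 br3] := br_tri.
by split=> [y z|x z|x y] a u v; rewrite /nijenhuis !(Jlin, br1, br2, br3);
  vector_ring.
Qed.

(** Every term of the identity has odd degree in J: replacing J by i E gives a
    factor i to the terms of degree one and i ^ 3 = - i to those of degree
    three. *)
Lemma nijenhuis_product (i : K) J : i ^+ 2 = -1 ->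
    (forall x y z, nijenhuis J x y z = 0) ->
  let E := - i *: J in forall x y z,
  E (br x y z) = br (E x) (E y) (E z) + br (E x) y z + br x (E y) z
    + br x y (E z) - E (br (E x) (E y) z) - E (br x (E y) (E z))
    - E (br (E x) y (E z)).
Proof.
move=> sqri J_int E x y z.
have EE u : E u = - i *: J u by rewrite /E scale_lfunE.
have JZ a u : J (a *: u) = a *: J u by exact: linearZ.
have /subr0_eq {}J_int := J_int x y z.
rewrite !EE !(trilinearE br_tri) !JZ J_int.
apply: v2r_inj; apply/rowP => ?; rewrite !coordE.
ring: sqri.
Qed.

End Nijenhuis.

Section Structure.
Variables (R : realType) (V : vectType R) (br : V -> V -> V -> V).
Variable J : 'End(V).
Local Notation VC := (complexification V).
Local Notation brC := (complexify_bracket br).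
Local Notation JC := (complexify_end J).

Lemma complexify_end_real x : JC (real_vector x) = real_vector (J x).
Proof. by rewrite complexify_endE linear0. Qed.

Lemma complexify_nijenhuis : trilinear br -> trilinear brC ->
    (forall x y z, nijenhuis br J x y z = 0) ->
  forall u v w, nijenhuis brC JC u v w = 0.
Proof.
move=> br_tri brC_tri J_int.
apply: trilinear_ext0; first exact: nijenhuis_trilinear.
move=> x y z; rewrite /nijenhuis.
rewrite !(complexify_end_real, complexify_bracket_real) //.
transitivity (real_vector (nijenhuis br J x y z)); last by rewrite J_int.
by congr (_, _); rewrite /= ?(oppr0, addr0).
Qed.

(** -i J (x + i y) = J y - i J x. *)
Lemma i_endE u :
  (- ('i%C : R[i]) *: JC) u = (J u.2, - J u.1).
Proof.
rewrite scale_lfunE complexify_endE complexification_scaleE /=.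
by rewrite oppr0 !scale0r !scaleN1r opprK !add0r.
Qed.

End Structure.

(** * Dimensions of the eigenspaces *)

(** A basis of [A] has a free image: a relation between the images with
    coefficients k_j is, by injectivity of [f], the image of a relation with
    coefficients s (k_j) in [A]. *)
Lemma dim_semilinear (K : fieldType) (V W : vectType K) (s : {rmorphism K -> K})
    (f : V -> W) (sK : involutive s) (f_add : {morph f : u v / u + v})
    (f_scale : forall a u, f (a *: u) = s a *: f u) (f_inj : injective f)
    (A : {vspace V}) (B : {vspace W}) :
  (forall u, u \in A -> f u \in B) -> (\dim A <= \dim B)%N.
Proof.
move=> fAB.
have f0 : f 0 = 0 by rewrite -[0 in LHS](scale0r 0) f_scale rmorph0 scale0r.
pose X := [tuple of map f (vbasis A)].
have /eqP dimX : free X.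
  apply/freeP => k; rewrite (eq_bigr (fun j => f (s (k j) *: (vbasis A)`_j))).
    rewrite -(big_morph f f_add f0) -[in RHS]f0 => /f_inj sum0 j.
    have /freeP/(_ (s \o k) sum0 j) := basis_free (vbasisP A).
    by rewrite /= => /(congr1 s); rewrite sK rmorph0.
  by move=> j _; rewrite f_scale sK (nth_map 0) ?size_tuple.
rewrite -[leqLHS](size_tuple X) -dimX; apply/dimvS/span_subvP => _ /mapP[u uX ->].
exact/fAB/vbasis_mem.
Qed.

Section ConjugateDim.
Variables (R : realType) (V : vectType R).
Local Notation VC := (complexification V).

Definition conj_vector (u : VC) : VC := (u.1, - u.2).

(** From F u = a u follows F (conj u) = - conj (a u) = - conj(a) conj(u). *)
Lemma leigenspace_conj (F : 'End(VC)) a :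
    (forall u, F (conj_vector u) = - conj_vector (F u)) ->
  (\dim (passmx.leigenspace F a) <= \dim (passmx.leigenspace F (- conjc a)))%N.
Proof.
move=> Fconj.
have conjD : {morph conj_vector : u v / u + v}.
  by move=> u v; rewrite /conj_vector /= opprD.
have conjZ c u : conj_vector (c *: u) = conjc c *: conj_vector u.
  case: c => c d; rewrite /conj_vector !complexification_scaleE /=.
  by rewrite scalerN !scaleNr opprK scalerN opprD.
have conj_inj : injective conj_vector.
  by move=> [x y] [x' y'] [-> /oppr_inj ->].
apply: (dim_semilinear (@conjcK R) conjD conjZ conj_inj).
move=> u; rewrite !memv_ker !add_lfunE !opp_lfunE !scale_lfunE !id_lfunE.
rewrite !subr_eq0 => /eqP Fu; rewrite Fconj Fu conjZ.
by rewrite scaleNr.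
Qed.

(** The map a |-> - conj(a) is an involution, so the inequality applied twice is
    an equality. *)
Lemma dim_leigenspace_conj (F : 'End(VC)) a :
    (forall u, F (conj_vector u) = - conj_vector (F u)) ->
  \dim (passmx.leigenspace F a) = \dim (passmx.leigenspace F (- conjc a)).
Proof.
move=> Fconj; apply: anti_leq; apply/andP; split.
  exact: leigenspace_conj.
have := leigenspace_conj (- conjc a) Fconj.
by have -> : - conjc (- conjc a) = a by rewrite rmorphN /= conjcK opprK.
Qed.

End ConjugateDim.

(** * The complex para-Kähler structure *)

Theorem theorem9p6 (R : realType) (g : vectType R)
    (br : g -> g -> g -> g) (omega : g -> g -> R) (J : 'End(g))
    (g_neq0 : exists x : g, x <> 0)
    (gK : pseudo_kahler br omega J) :
  para_kahler (complexify_bracket br) (complexify_form omega)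
    ((- ('i%C : R[i])) *: complexify_end J).
Proof.
have [br_lie om_sympl [J_sqr J_int] J_om] := gK.
have brC_lie := complexify_lie3 br_lie.
have [x x_neq0] := g_neq0.
have [om1 om2 _ _ _] := om_sympl.
have JN u : J (- u) = - J u by exact: linearN.
split; [exact: brC_lie | exact: complexify_symplectic | | ].
- split; first split.
  + move=> [y z]; rewrite !i_endE /=.
    by rewrite JN !J_sqr !opprK.
  + move=> /lfunP/(_ (real_vector x)); rewrite i_endE id_lfunE.
    by case; rewrite linear0 => /esym.
  + move=> /lfunP/(_ (real_vector x)); rewrite i_endE opp_lfunE id_lfunE.
    by case; rewrite linear0 => /esym/eqP; rewrite oppr_eq0 => /eqP.
  + apply: nijenhuis_product; first exact: lie3_trilinear.
      exact: sqr_i.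
    apply: complexify_nijenhuis; try exact: lie3_trilinear.
    by move=> a b c; rewrite /nijenhuis J_int subrr.
  + set F := _ *: _.
    have Fconj u : F (conj_vector u) = - conj_vector (F u).
      by rewrite !i_endE /conj_vector /= JN opprK.
    by rewrite (dim_leigenspace_conj 1 Fconj) conjc1.
move=> [a b] [c d]; rewrite !i_endE /complexify_form /=.
rewrite !(linear_forE (om1 _)) !(linear_forE (om2 _)) !J_om.
by apply/eqP; rewrite eq_complex /=; apply/andP; split; apply/eqP; ring.
Qed.
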